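(* Let $(M,d)$ be a complete, separable, proper geodesic metric space. Let $(\mathcal Z,\mathcal F,P)$ be a probability space and let $\phi:\mathcal Z\times M\to\mathbb R$ be such that: (i) for all $x\in M$, the map $\phi(\cdot,x)$ is measurable and integrable with respect to $P$; (ii) for $P$-almost all $z\in\mathcal Z$, $\phi(z,\cdot)$ is geodesically convex on $M$; (iii) there exists $L>0$ such that $\phi(z,\cdot)$ is $L$-Lipschitz on $M$ for all $z\in\mathcal Z$. Let $Z,Z_1,Z_2,\ldots$ be i.i.d. random variables in $\mathcal Z$ with distribution $P$, and for $x\in M$ and $n\geq 1$ set $$\Phi(x)=\mathbb E[\phi(Z,x)],\qquad \hat\Phi_n(x)=\frac1n\sum_{i=1}^n\phi(Z_i,x).$$ Let $M^*$ be the set of minimizers of $\Phi$ on $M$ and assume that $M^*$ is non-empty and bounded. For $n\geq 1$, let $\hat x_n$ be a minimizer of $\hat\Phi_n$ on $M$. Then $d(\hat x_n,M^* )\to 0$ almost surely as $n\to\infty$.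
   Context: A metric space $(M,d)$ is a geodesic space if for all $x,y\in M$ the set $\Gamma_{x,y}$ is non-empty, where $\Gamma_{x,y}$ is the set of continuous functions $\gamma:[0,1]\to M$ with $\gamma(0)=x$, $\gamma(1)=y$ and $d(\gamma(s),\gamma(t))=|s-t|\,d(x,y)$ for all $s,t\in[0,1]$. It is proper if all its closed bounded subsets are compact. A function $f:M\to\mathbb R$ is geodesically convex if for all $x,y\in M$, all $\gamma\in\Gamma_{x,y}$ and all $t\in[0,1]$, $f(\gamma(t))\leq(1-t)f(x)+tf(y)$. For a non-empty set $A\subseteq M$, $d(x,A)=\inf_{a\in A}d(x,a)$. *)

(* Defs.v *)
From HB Require Import structures.
From mathcomp Require Import all_boot all_order all_algebra finmap.
From mathcomp Require Import all_classical all_reals all_analysis.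

Set Implicit Arguments.
Unset Strict Implicit.
Unset Printing Implicit Defensive.

Import Order.TTheory GRing.Theory Num.Theory.
Import numFieldNormedType.Exports.

Local Open Scope classical_set_scope.
Local Open Scope ring_scope.

Section MetricSpaces.
Context {R : realType} {M : metricType R}.

(* The library bundles this property with a distinguished point in
   [completeType]; it is stated here for an arbitrary metric space. *)
Definition complete_space : Prop :=
  forall F : set_system M, ProperFilter F -> cauchy F ->
    exists l : M, F --> l.

Definition separable_space : Prop :=
  exists2 D : set M, countable D & dense D.

Definition metric_bounded (A : set M) : Prop :=
  exists r : R, forall x y, A x -> A y -> mdist x y <= r.

Definition proper_space : Prop :=
  forall A : set M, closed A -> metric_bounded A -> compact A.

(* Geodesics are functions on the whole of R; only their restriction to
   [0, 1] is ever constrained or used. *)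
Definition geodesics (x y : M) : set (R -> M) :=
  [set gamma : R -> M |
    [/\ {within `[0, 1]%classic, continuous gamma},
        gamma 0 = x,
        gamma 1 = y &
        forall s t : R, s \in `[0, 1]%R -> t \in `[0, 1]%R ->
          mdist (gamma s) (gamma t) = `|s - t| * mdist x y]].

Definition geodesic_space : Prop := forall x y : M, geodesics x y !=set0.

Definition geodesically_convex (f : M -> R) : Prop :=
  forall (x y : M) (gamma : R -> M), geodesics x y gamma ->
    forall t : R, t \in `[0, 1]%R ->
      f (gamma t) <= (1 - t) * f x + t * f y.

Definition metric_lipschitz (L : R) (f : M -> R) : Prop :=
  forall x y : M, `|f x - f y| <= L * mdist x y.

(* Meaningful for non-empty [A] only: the infimum of the empty set is 0. *)
Definition dist_set (x : M) (A : set M) : R := inf [set mdist x a | a in A].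

Definition minimizers (f : M -> R) : set M :=
  [set x | forall y : M, f x <= f y].

End MetricSpaces.

Arguments complete_space {R} M.
Arguments separable_space {R} M.
Arguments proper_space {R} M.
Arguments geodesic_space {R} M.

Section IID.
Context {R : realType} {d d' : measure_display}.
Context {Omega : measurableType d} {T : measurableType d'}.
Variable Pr : probability Omega R.

Definition mutually_independent (I : choiceType) (X : I -> {RV Pr >-> T}) :
    Prop :=
  forall (J : {fset I}) (A : I -> set T),
    (forall i, i \in J -> measurable (A i)) ->
    Pr (\bigcap_(i in [set` J]) (X i @^-1` A i)) =
    (\prod_(i <- J) Pr (X i @^-1` A i))%E.

Definition iid_with_law (P : probability T R) (I : choiceType)
    (X : I -> {RV Pr >-> T}) : Prop :=
  mutually_independent X /\
  forall i (A : set T), measurable A -> distribution Pr (X i) A = P A.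

End IID.

Section Objectives.
Context {R : realType} {d d' : measure_display}.
Context {Omega : measurableType d} {T : measurableType d'} {M : metricType R}.
Variables (Pr : probability Omega R) (phi : T -> M -> R).

(* The expectation is finite as soon as [phi^~ x] is integrable under the law
   of [Z], so [fine] loses nothing there. *)
Definition population_objective (Z : {RV Pr >-> T}) (x : M) : R :=
  fine 'E_Pr[fun w => phi (Z w) x].

(* The sample is Z 1, Z 2, ...; Z 0 is left for the generic copy that enters
   the population objective. *)
Definition empirical_objective (Z : nat -> {RV Pr >-> T}) (n : nat)
    (w : Omega) (x : M) : R :=
  n%:R^-1 * \sum_(1 <= i < n.+1) phi (Z i w) x.

End Objectives.

(* Main.v *)
Require Import Defs.
From mathcomp Require Import all_boot all_order all_algebra finmap.
From mathcomp Require Import all_classical all_reals all_analysis.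
From mathcomp Require Import measurable_realfun lra ring zify.

Set Implicit Arguments.
Unset Strict Implicit.
Unset Printing Implicit Defensive.

Import Order.TTheory GRing.Theory Num.Theory.
Import numFieldNormedType.Exports.

Local Open Scope classical_set_scope.
Local Open Scope ring_scope.

(* Fix x0 in M*. The increments phi(., q) - phi(., x0) are bounded by the
   Lipschitz hypothesis, so a strong law for bounded variables suffices: it
   follows from the second moments along the squares n = k^2 (where their sum
   converges) and from the boundedness of the increments in between.  Almost
   surely the law holds for all q in a countable dense set at once.  For such
   an outcome, the sphere K = {d(., M* ) = eps} is compact, and the Lipschitz
   bound together with compactness shows that the empirical objective is
   eventually larger on all of K than at x0.  If d(xhat_n, M* ) >= eps, a
   geodesic from x0 to xhat_n meets K, and there convexity bounds the empirical
   objective by its value at x0, which is a contradiction. *)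

(** * Strong law for bounded orthogonal variables *)

(** From one square to the next there are about [2k] steps, so [u] moves by [O(kB)] in between,
    which is negligible against [n >= k^2]. *)
Lemma cvg_mean_of_squares (R : realType) (u : nat -> R) (B : R) :
  (forall n, `|u n.+1 - u n| <= B) ->
  u (k.+1 ^ 2)%N / (k.+1 ^ 2)%:R @[k --> \oo] --> (0 : R) ->
  n%:R^-1 * u n @[n --> \oo] --> (0 : R).
Proof.
move=> uB ucvg; apply/cvgrPdist_lt => e e0.
have B0 : 0 <= B := le_trans (normr_ge0 _) (uB 0%N).
have dist_u m p : `|u (m + p)%N - u m| <= p%:R * B.
  elim: p => [|p ih]; first by rewrite addn0 subrr normr0 mul0r.
  have := ler_distD (u (m + p)%N) (u (m + p.+1)%N) (u m).
  have := uB (m + p)%N; rewrite addnS -natr1 mulrDl mul1r; lra.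
have e2 : 0 < e / 2 by rewrite divr_gt0.
have [K _ HK] : \forall k \near \oo,
    `|u (k.+1 ^ 2)%N / (k.+1 ^ 2)%:R| < e / 2.
  by move/cvgrPdist_lt: ucvg => /(_ _ e2); under eq_near do rewrite sub0r normrN.
(* Beyond [K] the quotients at squares are below [e / 2]; beyond [4B / e] the drift [2(k+1)B] is at
   most [(e / 2)(k+1)^2]. *)
have [N] : exists N, (K < N)%N && (Num.truncn (4 * B / e) < N)%N.
  by exists (maxn K (Num.truncn (4 * B / e))).+1; rewrite !ltnS leq_maxl leq_maxr.
move=> /andP[KN tN].
near=> n; rewrite sub0r normrN.
have nN : (N ^ 2 <= n)%N by near: n; exact: nbhs_infty_ge.
(* [k.+1] is the integer square root of [n]; it is at least [N] because [N ^ 2 <= n]. *)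
have [k] : exists k, (N <= k.+1)%N && (k.+1 ^ 2 <= n < k.+2 ^ 2)%N.
  have [|m|k Pk kmax] := @ex_maxnP (fun k => k.+1 ^ 2 <= n)%N n.
  - by exists N.-1; rewrite prednK// (leq_ltn_trans _ KN).
  - by move=> /(leq_trans _); apply; rewrite -mulnn; lia.
  exists k; rewrite Pk/= ltnNge; apply/andP; split.
    by have := kmax N.-1; rewrite prednK ?(leq_ltn_trans _ KN)// => /(_ nN); lia.
  by apply/negP => /kmax; rewrite ltnn.
move=> /andP[Nk /andP[kn nk]].
have k2 : 0 < (k.+1 ^ 2)%:R :> R by rewrite ltr0n expn_gt0.
have n0 : 0 < n%:R :> R by apply: lt_le_trans k2 _; rewrite ler_nat.
have uk : `|u (k.+1 ^ 2)%N| < e / 2 * n%:R.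
  have := HK k; rewrite normrM normfV (gtr0_norm k2) ltr_pdivrMr// => /(_ _)/lt_le_trans.
  apply; first by rewrite /= -ltnS (leq_trans KN).
  by rewrite ler_pM2l// ler_nat.
have du : `|u n - u (k.+1 ^ 2)%N| <= 2 * k.+1%:R * B.
  have := dist_u (k.+1 ^ 2)%N (n - k.+1 ^ 2)%N; rewrite subnKC// => /le_trans; apply.
  rewrite ler_wpM2r// -natrM ler_nat; nia.
have Bk : 2 * k.+1%:R * B <= e / 2 * n%:R.
  have Be : 4 * B <= e * k.+1%:R.
    rewrite [e * _]mulrC -ler_pdivrMr//; apply: ltW.
    by apply: lt_le_trans (truncnS_gt _) _; rewrite ler_nat (leq_trans tN).
  have kn' : k.+1%:R * k.+1%:R <= n%:R :> R by rewrite -natrM ler_nat mulnn.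
  have k0 : 0 <= k.+1%:R :> R by [].
  nra.
rewrite normrM normfV (gtr0_norm n0) ltr_pdivrMl//.
have := ler_distD (u (k.+1 ^ 2)%N) (u n) 0; rewrite !subr0; lra.
Unshelve. all: by end_near. Qed.

Lemma bounded_integrable (R : realType) (d : measure_display)
  (T : measurableType d) (P : probability T R) (f : T -> R) (C : R) :
  measurable_fun [set: T] f -> (forall w, `|f w| <= C) ->
  P.-integrable [set: T] (EFin \o f).
Proof.
move=> mf fC; apply: measurable_bounded_integrable => //.
  by rewrite [ltLHS]probability_setT ltry.
by exists C; split => [|r Cr w _]; [exact: num_real|exact: le_trans (fC w) (ltW Cr)].
Qed.

Lemma sum_inv_squares_le2 (R : realType) n :
  \sum_(0 <= k < n) (k.+1 ^ 2)%:R^-1 <= 2 :> R.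
Proof.
case: n => [|n]; first by rewrite big_geq.
(* The sharper bound carries the induction, since [1/(x+1)^2] is at most [1/x - 1/(x+1)]; the
   difference is [1/(x(x+1)^2)]. *)
suff: \sum_(0 <= k < n.+1) (k.+1 ^ 2)%:R^-1 <= 2 - n.+1%:R^-1 :> R.
  by move=> /le_trans; apply; rewrite gerBl.
elim: n => [|n ih]; first by rewrite big_nat1 !invr1; lra.
rewrite big_nat_recr//=; apply: le_trans (lerD ih (lexx _)) _.
rewrite natrX -[n.+2%:R]natr1; set x : R := n.+1%:R.
have x0 : 0 < x by rewrite ltr0n.
have -> : 2 - (x + 1)^-1 =
    2 - x^-1 + (x + 1) ^- 2 + (x * (x + 1) ^+ 2)^-1.
  by field; apply/andP; split; lra.
by rewrite lerDl invr_ge0 mulr_ge0 ?sqr_ge0// ltW.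
Qed.

Section BoundedOrthogonalSLLN.
Context {R : realType} {d : measure_display} {T : measurableType d}.
Variables (P : probability T R) (X : nat -> T -> R) (B : R).
Hypothesis mX : forall i, measurable_fun [set: T] (X i).
Hypothesis XB : forall i w, `|X i w| <= B.
Hypothesis orthoX : forall i j, i != j -> \int[P]_w (X i w * X j w) = 0.

Let S n w := \sum_(i < n) X i w.

Let B0 : 0 <= B.
Proof.
(* A space of total mass 1 has a point, and there [B] dominates an absolute value. *)
have [w _] : [set: T] !=set0.
  apply/set0P/negP => /eqP T0; have := probability_setT P.
  by rewrite T0 measure0 => -[] /eqP; rewrite eq_sym oner_eq0.
exact: le_trans (XB 0%N w).
Qed.

Let mS n : measurable_fun [set: T] (S n).
Proof. exact: measurable_sum. Qed.

Let SB n w : `|S n w| <= n%:R * B.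
Proof.
have -> : n%:R * B = \sum_(i < n) B by rewrite sumr_const card_ord mulr_natl.
by rewrite (le_trans (ler_norm_sum _ _ _))// ler_sum.
Qed.

Let int_prod (f g : T -> R) (a b : R) :
  measurable_fun [set: T] f -> measurable_fun [set: T] g ->
  (forall w, `|f w| <= a) -> (forall w, `|g w| <= b) ->
  P.-integrable [set: T] (EFin \o (fun w => f w * g w)).
Proof.
move=> mf mg fa gb; apply: (@bounded_integrable _ _ _ _ _ (a * b)).
  exact: measurable_funM.
by move=> w; rewrite normrM ler_pM.
Qed.

Let ortho_S n j : (n <= j)%N -> \int[P]_w (S n w * X j w) = 0.
Proof.
elim: n => [|n ih] nj.
  under eq_Rintegral do rewrite /S big_ord0 mul0r.
  by rewrite Rintegral_cst// mul0r.
under eq_Rintegral do rewrite /S big_ord_recr/= mulrDl.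
rewrite RintegralD//; last 2 first.
- exact: int_prod (mS n) (mX j) (SB n) (XB j).
- exact: int_prod (mX n) (mX j) (XB n) (XB j).
by rewrite ih 1?ltnW// orthoX ?addr0// ltn_eqF.
Qed.

(** When the square of [S n.+1] is expanded, the cross term integrates to zero by orthogonality and
    the new square adds at most [B ^+ 2]. *)
Lemma second_moment_sum_le n : \int[P]_w (S n w ^+ 2) <= n%:R * B ^+ 2.
Proof.
elim: n => [|n ih].
  under eq_Rintegral do rewrite /S big_ord0 expr0n/=.
  by rewrite Rintegral_cst// !mul0r.
have SS : (fun w => S n.+1 w ^+ 2) =
    (fun w => S n w * S n w + (2 * (S n w * X n w) + X n w * X n w)).
  by apply/funext => w; rewrite {1}/S big_ord_recr/= -/(S n w); ring.
have iSS := int_prod (mS n) (mS n) (SB n) (SB n).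
have iSX := int_prod (mS n) (mX n) (SB n) (XB n).
have iXX := int_prod (mX n) (mX n) (XB n) (XB n).
have i2SX : P.-integrable [set: T] (EFin \o (fun w => 2 * (S n w * X n w))).
  exact: (integrableZl measurableT 2 iSX).
rewrite SS RintegralD//; last first.
  exact: (integrableD measurableT i2SX iXX).
rewrite RintegralD// RintegralZl// ortho_S// mulr0 add0r -natr1 mulrDl mul1r.
rewrite lerD//.
have -> : B ^+ 2 = \int[P]_w (B ^+ 2).
  by rewrite Rintegral_cst// [X in fine X]probability_setT mulr1.
apply: le_Rintegral => //.
  by apply: (@bounded_integrable _ _ _ _ _ (B ^+ 2)) => // w; rewrite ger0_norm ?sqr_ge0.
by move=> w _; rewrite -expr2 -real_normK ?num_real// lerXn2r ?nnegrE.
Qed.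

(** The squared averages at square times have a summable sequence of integrals. Their sum is thus
    integrable, hence almost surely finite, and its terms tend to 0. *)
Lemma bounded_orthogonal_slln :
  {ae P, forall w, n%:R^-1 * \sum_(i < n) X i w @[n --> \oo] --> (0 : R)}.
Proof.
pose Y k w := (S (k.+1 ^ 2) w / (k.+1 ^ 2)%:R) ^+ 2.
have mY k : measurable_fun [set: T] (Y k).
  by apply: measurable_funX; apply: measurable_funM.
have Y0 k w : 0 <= Y k w by exact: sqr_ge0.
(* With [m = (k+1)^2] terms, the second moment [m B^2] is divided by [m^2]. *)
have intY k : (\int[P]_w (Y k w)%:E <= (B ^+ 2 * (k.+1 ^ 2)%:R^-1)%:E)%E.
  have iY : P.-integrable [set: T] (EFin \o Y k).
    apply: (@bounded_integrable _ _ _ _ _ (B ^+ 2)) => // w.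
    rewrite ger0_norm// /Y -real_normK ?num_real// lerXn2r ?nnegrE//.
    by rewrite normrM normfV normr_nat ler_pdivrMr ?ltr0n ?expn_gt0// mulrC.
  rewrite -[leLHS]fineK ?integrable_fin_num// lee_fin.
  rewrite -/(Rintegral _ _ _) (_ : Y k = fun w =>
      ((k.+1 ^ 2)%:R ^- 2) * (S (k.+1 ^ 2) w ^+ 2)); last first.
    by apply/funext => w; rewrite /Y exprMn exprVn mulrC.
  have n0 : 0 < (k.+1 ^ 2)%:R :> R by rewrite ltr0n expn_gt0.
  rewrite RintegralZl//; last first.
    exact: int_prod (mS _) (mS _) (SB _) (SB _).
  rewrite ler_pdivrMl ?exprn_gt0//.
  apply: le_trans (second_moment_sum_le _) _.
  by rewrite le_eqVlt; apply/orP; left; apply/eqP; field; rewrite gt_eqF.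
pose F w := (\sum_(0 <= k <oo) (Y k w)%:E)%E.
have F0 w : (0 <= F w)%E by apply: nneseries_ge0 => k _ _; rewrite lee_fin.
have mF : measurable_fun [set: T] F.
  apply: ge0_emeasurable_sum => // k; first by move=> w _ _; rewrite lee_fin.
  by move=> _; exact/measurable_EFinP.
(* The terms are nonnegative, so sum and integral commute, and the total is at most [2 B^2]. *)
have iF : P.-integrable [set: T] F.
  apply/integrableP; split => //.
  under eq_integral do rewrite gee0_abs//.
  rewrite integral_nneseries//; last 2 first.
    by move=> k; exact/measurable_EFinP.
    by move=> k w _; rewrite lee_fin.
  apply: (@le_lt_trans _ _ (B ^+ 2 * 2)%:E); last exact: ltry.
  apply: lime_le.
    by apply: is_cvg_nneseries => k _ _; apply: integral_ge0 => w _; rewrite lee_fin.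
  apply: nearW => n; apply: le_trans (lee_sum _ (fun k _ => intY k)) _.
  rewrite sumEFin lee_fin -mulr_sumr ler_wpM2l ?sqr_ge0//.
  exact: sum_inv_squares_le2.
have /= := integrable_ae measurableT iF; apply: filterS => w /(_ I) Fw.
apply: (@cvg_mean_of_squares _ (S ^~ w) B).
  move=> n; suff -> : S n.+1 w - S n w = X n w by [].
  by rewrite /S big_ord_recr/= addrAC subrr add0r.
have /cvg_series_cvg_0 Yw : cvgn (series (Y ^~ w)).
  apply: nondecreasing_is_cvgn.
    by apply/nondecreasing_seqP => n; rewrite seriesSr lerDl.
  exists (fine (F w)) => _ [n _ <-].
  rewrite -lee_fin fineK// -sumEFin.
  by apply: nneseries_lim_ge => k _ _; rewrite lee_fin.
(* [Y k w] is a square, so it is compared with [e ^+ 2] to bring the average itself below [e]. *)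
apply/cvgrPdist_lt => e e0; have e2 : 0 < e ^+ 2 by rewrite exprn_gt0.
move/cvgrPdist_lt: Yw => /(_ _ e2); apply: filterS => k.
rewrite !sub0r !normrN ger0_norm// /Y -real_normK ?num_real//.
by rewrite ltr_pXn2r// ?nnegrE ?ltW.
Qed.

End BoundedOrthogonalSLLN.

(** * Distance to a set *)

Section DistanceToSet.
Context {R : realType} {M : metricType R}.
Implicit Types (x y : M) (A : set M).

Lemma dist_set_le x a A : A a -> dist_set x A <= mdist x a.
Proof.
move=> Aa; apply: ge_inf; last by exists a.
by exists 0 => _ [b _ <-]; exact: mdist_ge0.
Qed.

Lemma dist_set_ge0 x A : A !=set0 -> 0 <= dist_set x A.
Proof.
move=> [a Aa]; apply: lb_le_inf; first by exists (mdist x a), a.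
by move=> _ [b _ <-]; exact: mdist_ge0.
Qed.

Lemma dist_set_mem x A : A x -> dist_set x A = 0.
Proof.
move=> Ax; apply/eqP; rewrite eq_le dist_set_ge0 ?andbT; last by exists x.
by rewrite -(mdistxx x) dist_set_le.
Qed.

Lemma dist_set_adherent x A r : A !=set0 -> dist_set x A < r ->
  exists2 a, A a & mdist x a < r.
Proof.
move=> [a0 Aa0] xr.
have [||_ [a Aa <-] xa] := @inf_adherent _ [set mdist x a | a in A] (r - dist_set x A).
- by rewrite subr_gt0.
- split; first by exists (mdist x a0), a0.
  by exists 0 => _ [b _ <-]; exact: mdist_ge0.
- by exists a => //; rewrite (lt_le_trans xa)// /dist_set; lra.
Qed.

Lemma dist_set_lipschitz A : A !=set0 -> metric_lipschitz 1 (dist_set ^~ A).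
Proof.
move=> A0 x y; rewrite mul1r.
have le u v : dist_set u A <= dist_set v A + mdist u v.
  (* The infimum need not be attained, hence the slack [e]. *)
  apply/ler_addgt0Pl => e e0.
  have [|a Aa va] := @dist_set_adherent v A (dist_set v A + e) A0; first lra.
  have := dist_set_le u Aa; have := metric_triangle u v a; lra.
have := le x y; have := le y x; rewrite (metric_sym y x) => ? ?.
rewrite ler_norml; lra.
Qed.

End DistanceToSet.

Lemma metric_lipschitz_continuous (R : realType) (M : metricType R) (L : R)
  (f : M -> R) : 0 < L -> metric_lipschitz L f -> continuous f.
Proof.
move=> L0 Lf x; apply/cvgrPdist_lt => e e0.
have eL : 0 < e / L by rewrite divr_gt0.
have : \forall y \near x, ball x (e / L) y by exact: nbhsx_ballx.
apply: filterS => y; rewrite ballEmdist/= => xy.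
rewrite (le_lt_trans (Lf x y))// mulrC -ltr_pdivlMr//.
Qed.

(** * Minimizers of convex functions converging on a dense set *)

Section MinimizersOfConvexSequence.
Context {R : realType} {M : metricType R}.
Variables (f : M -> R) (fn : nat -> M -> R) (L : R) (D : set M) (x0 : M).
Hypotheses (hproper : proper_space M) (hgeodesic : geodesic_space M).
Hypotheses (L0 : 0 < L) (Lf : metric_lipschitz L f)
  (Lfn : forall n, metric_lipschitz L (fn n)).
Hypotheses (dD : dense D)
  (cvgD : forall q, D q -> fn n q - fn n x0 @[n --> \oo] --> f q - f x0).
Hypotheses (minx0 : minimizers f x0) (bmin : metric_bounded (minimizers f)).

(** Convergence is given on [D] only, so the comparison goes through a point of [D] close to [y].
    The common Lipschitz constant makes it uniform near [y], the form in which compactness can use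
    it. *)
Lemma gt_eventually_near (y : M) : f x0 < f y ->
  \forall y' \near y & n \near \oo, fn n x0 < fn n y'.
Proof.
(* Four errors below [e] occur: from [y'] to [y] and from [y] to [q] under [fn n], from [fn n] to
   [f] at [q], and from [q] to [y] under [f]. The gap [8 * e] absorbs them. *)
move=> fxy; pose e := (f y - f x0) / 8.
have e0 : 0 < e by rewrite divr_gt0 ?subr_gt0.
have eE : f y = f x0 + 8 * e by rewrite /e; field.
have d0 : 0 < e / L by rewrite divr_gt0.
have [q []] : ball y (e / L) `&` D !=set0.
  (* Density is about open sets, hence the interior of the ball. *)
  have [q [qb Dq]] : interior (ball y (e / L)) `&` D !=set0.
    apply: dD; last exact: open_interior.
    by exists y; exact: nbhsx_ballx.
  by exists q; split => //; exact: interior_subset.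
rewrite ballEmdist/= => yq Dq.
have Ld (a b : M) : mdist a b < e / L -> L * mdist a b < e.
  by rewrite ltr_pdivlMr// mulrC.
near=> y' n => /=.
have : `|f q - f x0 - (fn n q - fn n x0)| < e.
  by near: n; move/cvgrPdist_lt: (cvgD Dq); exact.
have yy' : mdist y y' < e / L.
  by near: y'; have := nbhsx_ballx y _ d0; rewrite ballEmdist.
have := Lf y q; have := Lfn n q y.
have := Lfn n y y'; have := Ld _ _ yy'; have := Ld _ _ yq.
rewrite (metric_sym q y) !ler_norml !ltr_norml => ? ?.
move=> /andP[? ?] /andP[? ?] /andP[? ?] /andP[? ?]; lra.
Unshelve. all: by end_near. Qed.

(** The deterministic core, applied outcome by outcome with [fn] the empirical objectives. *)
Lemma cvg_dist_minimizers (xn : nat -> M) :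
  (forall n, geodesically_convex (fn n)) ->
  (forall n, (1 <= n)%N -> minimizers (fn n) (xn n)) ->
  dist_set (xn n) (minimizers f) @[n --> \oo] --> (0 : R).
Proof.
move=> cfn minxn; apply/cvgrPdist_lt => e e0.
have A0 : minimizers f !=set0 by exists x0.
have Ldist := @dist_set_lipschitz _ _ _ A0.
have cdist : continuous (dist_set ^~ (minimizers f)).
  exact: metric_lipschitz_continuous Ldist.
pose K : set M := [set y | dist_set y (minimizers f) = e].
have cK : compact K.
  apply: hproper.
    by apply: (@preimage_closed _ _ _ [set e]) => // y; exact: cdist.
  (* Points of [K] lie within [e + e] of [minimizers f], the second [e] being slack for the infimum;
     [r] bounds the distance between the two nearby minimizers. *)
  have [r br] := bmin; exists (r + 2 * (e + e)) => x y Kx Ky.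
  have [|a Aa xa] := @dist_set_adherent _ _ x _ (e + e) A0.
    by rewrite Kx; lra.
  have [|b Ab yb] := @dist_set_adherent _ _ y _ (e + e) A0.
    by rewrite Ky; lra.
  have := metric_triangle x a y; have := metric_triangle a b y.
  have := br _ _ Aa Ab; rewrite (metric_sym b y); lra.
have : \forall n \near \oo, K `<=` (fun y => fn n x0 < fn n y).
  (* Compactness turns the local statements into one rank valid on all of [K]. A point of [K] with
     the value [f x0] would be a minimizer, at distance 0 instead of [e]. *)
  move/compact_near_coveringP: cK; apply => y Ky.
  apply: gt_eventually_near; rewrite lt_neqAle minx0 andbT.
  apply/eqP => fxy.
  suff : dist_set y (minimizers f) = 0 by rewrite Ky => ee; move: e0; rewrite ee ltxx.
  by apply: dist_set_mem => z; rewrite -fxy; exact: minx0.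
move=> Kn; near=> n.
rewrite sub0r normrN ger0_norm ?dist_set_ge0// ltNge; apply/negP => en.
have [gamma Gg] := hgeodesic x0 (xn n).
have [cg g0 g1 _] := Gg.
(* Along the geodesic the distance to [minimizers f] starts at 0 and ends at [e] or more. *)
have [t t01 gt] : exists2 t, t \in `[0, 1]%R & dist_set (gamma t) (minimizers f) = e.
  apply: (@IVT _ (fun t => dist_set (gamma t) (minimizers f))) => //.
    by move=> t; exact: (continuous_comp (cg t) (cdist (gamma t))).
  by rewrite g0 g1 (dist_set_mem minx0) ge_min le_max (ltW e0) en orbT.
have : fn n x0 < fn n (gamma t) by apply: (near Kn n).
apply/negP; rewrite -leNgt.
apply: le_trans (cfn n _ _ _ Gg t t01) _.
have xnx0 : fn n (xn n) <= fn n x0.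
  by apply: minxn; near: n; exact: nbhs_infty_ge.
move: t01; rewrite in_itv/= => /andP[t0 t1].
have := ler_wpM2l t0 xnx0; lra.
Unshelve. all: by end_near. Qed.

End MinimizersOfConvexSequence.

(** * Integrals and the strong law for i.i.d. samples *)

Section IIDSamples.
Context {R : realType} {dO dZ : measure_display}.
Context {Omega : measurableType dO} {ZZ : measurableType dZ}.
Variables (Pr : probability Omega R) (P : probability ZZ R).
Variable Z : nat -> {RV Pr >-> ZZ}.
Hypothesis hiid : iid_with_law P Z.

Lemma iid_ae (i : nat) (Q : ZZ -> Prop) :
  {ae P, forall z, Q z} -> {ae Pr, forall w, Q (Z i w)}.
Proof.
move=> [N [mN N0 QN]]; exists (Z i @^-1` N); split.
- by rewrite -[_ @^-1` _]setTI; exact: measurable_funP.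
- by rewrite -N0; exact: hiid.2.
- by move=> w /= nQ; apply: QN.
Qed.

Lemma iid_joint_law (i j : nat) (A B : set ZZ) : i != j ->
  measurable A -> measurable B ->
  Pr (Z i @^-1` A `&` Z j @^-1` B) = (P A * P B)%E.
Proof.
move=> ij mA mB.
pose C k := if k == i then A else B.
have := @hiid.1 [fset i; j]%fset C.
rewrite (_ : \bigcap_(k in _) _ = Z i @^-1` A `&` Z j @^-1` B).
  move=> ->; last by move=> k _; rewrite /C; case: ifP.
  rewrite big_fsetU1/= ?inE// big_seq_fset1 /C eqxx eq_sym (negbTE ij).
  by congr (_ * _)%E; exact: hiid.2.
apply/seteqP; split => w /=.
  move=> CC; split.
    by have := CC i; rewrite /C eqxx /=; apply; rewrite !inE eqxx.
  have := CC j; rewrite /C eq_sym (negbTE ij) /=; apply.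
  by rewrite !inE eqxx orbT.
move=> [Aw Bw] k /=; rewrite !inE => /orP[]/eqP-> /=; rewrite /C.
  by rewrite eqxx.
by rewrite eq_sym (negbTE ij).
Qed.

Lemma iid_integral (i : nat) (f : ZZ -> \bar R) :
  P.-integrable [set: ZZ] f ->
  (\int[Pr]_w f (Z i w) = \int[P]_z f z)%E.
Proof.
move=> intf.
have lawE (g : ZZ -> \bar R) :
    (\int[distribution Pr (Z i)]_z g z = \int[P]_z g z)%E.
  by apply: eq_measure_integral => A mA _; exact: (hiid.2 i A mA).
have /integrableP[mf foo] := intf.
rewrite -lawE integral_distribution//; apply/integrableP; split.
  exact: measurableT_comp.
rewrite -(@ge0_integral_distribution _ _ _ _ _ Pr (Z i) (abse \o f))//=.
- by rewrite lawE.
- exact: measurableT_comp.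
Qed.

(** The law of the pair [(Z i, Z j)] agrees with [P \x P] on rectangles, hence everywhere by
    uniqueness of the product measure; Fubini then factors the integral. *)
Lemma iid_integral_prod (i j : nat) (h : ZZ -> R) (B : R) : i != j ->
  measurable_fun [set: ZZ] h -> (forall z, `|h z| <= B) ->
  \int[Pr]_w (h (Z i w) * h (Z j w)) = (\int[P]_z h z) ^+ 2.
Proof.
move=> ij mh hB.
pose q w := (Z i w, Z j w).
have mq : measurable_fun [set: Omega] q by exact: measurable_fun_pair.
pose Q : {mfun Omega >-> (ZZ * ZZ)%type} := mfun_Sub (mem_set mq).
pose k (z : ZZ * ZZ) : \bar R := (h z.1 * h z.2)%:E.
have mk : measurable_fun [set: ZZ * ZZ] (fun z => h z.1 * h z.2).
  exact: measurable_funM (measurableT_comp mh measurable_fst)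
    (measurableT_comp mh measurable_snd).
have kB z : `|h z.1 * h z.2| <= B * B by rewrite normrM ler_pM.
have ih := bounded_integrable P mh hB.
transitivity (fine (\int[P \x P]_z k z)%E).
  rewrite (eq_measure_integral (distribution Pr Q)); last first.
    move=> C mC _; apply: product_measure_unique => // A A' mA mA'.
    exact: iid_joint_law.
  rewrite integral_distribution//; last first.
    have mkq := measurableT_comp mk mq.
    have := bounded_integrable Pr mkq (fun w => kB (q w)).
    exact.
  exact/measurable_EFinP.
rewrite -integral12_prod_meas1; last exact: bounded_integrable kB.
rewrite /fubini_F /k/=.
have ihE : (\int[P]_z (h z)%:E)%E = (\int[P]_z h z)%:E.
  by rewrite fineK// integrable_fin_num.
under eq_integral => x _.
  under eq_integral do rewrite EFinM.
  rewrite integralZl// ihE -EFinM.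
  over.
exact: RintegralZr.
Qed.

Lemma bounded_slln (g : ZZ -> R) (B : R) :
  measurable_fun [set: ZZ] g -> (forall z, `|g z| <= B) ->
  {ae Pr, forall w, n%:R^-1 * (\sum_(1 <= i < n.+1) g (Z i w))
    @[n --> \oo] --> \int[P]_z g z}.
Proof.
move=> mg gB; set m := \int[P]_z g z.
have ig := bounded_integrable P mg gB.
(* Centring makes the variables orthogonal: the integral of a product is the square of the mean of
   [h], which is 0. *)
pose h z := g z - m.
have mh : measurable_fun [set: ZZ] h by apply: measurable_funB.
have hB z : `|h z| <= B + `|m| by rewrite (le_trans (ler_normB _ _))// lerD2r.
have h0 : \int[P]_z h z = 0.
  rewrite RintegralB//; last exact: finite_measure_integrable_cst.
  by rewrite Rintegral_cst// [X in fine X]probability_setT mulr1 subrr.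
have mhZ i : measurable_fun [set: Omega] (fun w => h (Z i.+1 w)).
  exact: (measurableT_comp mh).
have orthoh i j : i != j -> \int[Pr]_w (h (Z i.+1 w) * h (Z j.+1 w)) = 0.
  by move=> ij; rewrite (iid_integral_prod _ mh hB) ?eqSS// h0 expr0n.
have := bounded_orthogonal_slln mhZ (fun i w => hB (Z i.+1 w)) orthoh.
apply: filterS => w hw.
rewrite -[X in _ --> X]add0r.
apply: cvg_trans (cvgD hw (cvg_cst m)).
apply: near_eq_cvg; near=> n => /=.
(* The mean [m] is recovered as [n^-1 * (n * m)], which fails at [n = 0]; hence an eventual
   equality. *)
have n0 : n%:R != 0 :> R by rewrite pnatr_eq0 -lt0n; near: n; exact: nbhs_infty_gt.
rewrite big_add1/= big_mkord.
rewrite -[LHS]/(n%:R^-1 * (\sum_(i < n) (g (Z i.+1 w) - m)) + m).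
rewrite sumrB sumr_const card_ord -[m *+ n]mulr_natl.
by field.
Unshelve. all: by end_near. Qed.

End IIDSamples.

(** * Empirical and population objectives *)

Section EmpiricalObjective.
Context {R : realType} {dO dZ : measure_display}.
Context {Omega : measurableType dO} {ZZ : measurableType dZ} {M : metricType R}.
Variables (Pr : probability Omega R) (phi : ZZ -> M -> R).
Variable Z : nat -> {RV Pr >-> ZZ}.

Lemma empirical_objective_convex n w :
  (forall i, geodesically_convex (phi (Z i w))) ->
  geodesically_convex (empirical_objective phi Z n w).
Proof.
move=> cphi x y gamma Gg t t01.
rewrite /empirical_objective [_ * (n%:R^-1 * _)]mulrCA.
rewrite [t * _]mulrCA -mulrDr ler_wpM2l ?invr_ge0//.
by rewrite !mulr_sumr -big_split/= ler_sum// => i _; exact: cphi Gg t t01.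
Qed.

Lemma empirical_objective_lipschitz n w (L : R) : 0 <= L ->
  (forall z, metric_lipschitz L (phi z)) ->
  metric_lipschitz L (empirical_objective phi Z n w).
Proof.
move=> L0 Lphi x y; rewrite /empirical_objective -mulrBr -sumrB normrM.
rewrite ger0_norm ?invr_ge0//.
have Ld : 0 <= L * mdist x y by rewrite mulr_ge0// mdist_ge0.
(* For [n = 0] the factor [0^-1] is 0 by convention. *)
case: n => [|n]; first by rewrite invr0 mul0r.
rewrite ler_pdivrMl// (le_trans (ler_norm_sum _ _ _))//.
apply: (@le_trans _ _ (\sum_(1 <= i < n.+2) L * mdist x y)).
  by apply: ler_sum => i _; exact: Lphi.
by rewrite sumr_const_nat subn1/= mulr_natl.
Qed.

End EmpiricalObjective.

Lemma population_objectiveE (R : realType) (M : metricType R)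
  (dO dZ : measure_display) (Omega : measurableType dO) (ZZ : measurableType dZ)
  (Pr : probability Omega R) (P : probability ZZ R) (phi : ZZ -> M -> R)
  (Z : nat -> {RV Pr >-> ZZ}) (i : nat) (x : M) :
  iid_with_law P Z -> P.-integrable [set: ZZ] (fun z => (phi z x)%:E) ->
  population_objective phi (Z i) x = \int[P]_z phi z x.
Proof.
move=> hiid iphi; rewrite /population_objective unlock /Rintegral.
by rewrite -(iid_integral hiid i iphi).
Qed.

(* The i.i.d. family is indexed by nat: Z 0 is the generic copy Z, and
   Z 1, Z 2, ... is the sample. *)
Theorem theorem1 (R : realType) (M : metricType R)
  (hcomplete : complete_space M)
  (hseparable : separable_space M)
  (hproper : proper_space M)
  (hgeodesic : geodesic_space M)
  (dZ : measure_display) (ZZ : measurableType dZ) (P : probability ZZ R)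
  (phi : ZZ -> M -> R)
  (hint : forall x : M,
    measurable_fun [set: ZZ] (phi^~ x) /\
    P.-integrable [set: ZZ] (fun z => (phi z x)%:E))
  (hconvex : {ae P, forall z, geodesically_convex (phi z)})
  (hlipschitz : exists2 L : R, 0 < L & forall z, metric_lipschitz L (phi z))
  (dO : measure_display) (Omega : measurableType dO) (Pr : probability Omega R)
  (Z : nat -> {RV Pr >-> ZZ})
  (hiid : iid_with_law P Z)
  (hMstar0 : minimizers (population_objective phi (Z 0%N)) !=set0)
  (hMstarb : metric_bounded (minimizers (population_objective phi (Z 0%N))))
  (xhat : nat -> Omega -> M)
  (hxhat : forall n, (1 <= n)%N ->
    {ae Pr, forall w, minimizers (empirical_objective phi Z n w) (xhat n w)}) :
  {ae Pr, forall w,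
    dist_set (xhat n w) (minimizers (population_objective phi (Z 0%N)))
      @[n --> \oo] --> (0 : R)}.
Proof.
have [L L0 Lphi] := hlipschitz.
have [D cD dD] := hseparable.
have [x0 minx0] := hMstar0.
have PhiE x := population_objectiveE 0 hiid (hint x).2.
(* A sequence covering [D] allows countable intersections of almost sure events; if [D] is empty,
   any sequence will do. *)
have [e De] : exists e : nat -> M, D `<=` range e.
  have [D0|[e]] := pfcard_geP cD.
    by exists (fun=> x0); rewrite D0.
  by exists e; exact: surj.
(* The pointwise bound is integrated; a constant integrates to itself because [P] has mass 1. *)
have LPhi : metric_lipschitz L (population_objective phi (Z 0%N)).
  have ub x y z : phi z x <= phi z y + L * mdist x y.
    by have := Lphi z x y; rewrite ler_norml; lra.
  have le x y : population_objective phi (Z 0%N) x <=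
      population_objective phi (Z 0%N) y + L * mdist x y.
    have ic : P.-integrable [set: ZZ] (EFin \o cst (L * mdist x y)).
      exact: finite_measure_integrable_cst.
    rewrite !PhiE -[X in _ + X](_ : \int[P]_z (L * mdist x y) = _); last first.
      by rewrite Rintegral_cst// [X in fine X]probability_setT mulr1.
    rewrite -RintegralD//; [|exact: (hint y).2].
    apply: le_Rintegral => //; [exact: (hint x).2|].
    exact: (integrableD measurableT (hint y).2 ic).
  move=> x y; have := le x y; have := le y x; rewrite (metric_sym y x).
  by rewrite ler_norml; lra.
(* The increments from [x0] are bounded by [L * mdist (e k) x0], whereas [phi] itself is only known
   to be integrable. *)
have cvge : {ae Pr, forall w, forall k,
    empirical_objective phi Z n w (e k) - empirical_objective phi Z n w x0
      @[n --> \oo] -->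
    population_objective phi (Z 0%N) (e k) -
      population_objective phi (Z 0%N) x0}.
  apply: ae_foralln => k.
  have mpsi : measurable_fun [set: ZZ] (fun z => phi z (e k) - phi z x0).
    by apply: measurable_funB; exact: (hint _).1.
  have := bounded_slln hiid mpsi (fun z => Lphi z (e k) x0).
  rewrite RintegralB//; [|exact: (hint _).2|exact: (hint _).2].
  rewrite -!PhiE; apply: filterS => w.
  under eq_fun do rewrite sumrB mulrBr.
  exact.
have cphi := ae_foralln (fun i => iid_ae hiid i hconvex).
have minxhat : {ae Pr, forall w, forall n, (1 <= n)%N ->
    minimizers (empirical_objective phi Z n w) (xhat n w)}.
  apply: ae_foralln => -[|n]; first exact: aeW.
  by apply: filterS (hxhat n.+1 isT).
(* On the intersection of the three almost sure events the deterministic lemma applies. *)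
apply: filterS3 cvge cphi minxhat => w cvgw cw minw.
apply: (cvg_dist_minimizers (fn := fun n => empirical_objective phi Z n w)
  (D := D) hproper hgeodesic L0 LPhi _ dD _ minx0 hMstarb _ minw).
- by move=> n; apply: empirical_objective_lipschitz; rewrite ?ltW.
- by move=> q /De[k _ <-]; exact: cvgw.
- by move=> n; exact: empirical_objective_convex.
Qed.
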